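(* Let $\mathbb{N}^{\mathrm{sf}}:=\{d\in\mathbb{Z}_{\ge 2}: d \text{ squarefree}\}$ and let $U:=\{d\in\mathbb{N}^{\mathrm{sf}}: d\ge 5 \text{ and } -d\not\equiv 1\pmod 8\}$. Then the relative density of $U$ in $\mathbb{N}^{\mathrm{sf}}$ exists and $\delta_{\mathrm{rel}}(U)=\frac56$.
   Context: For $S\subseteq\mathbb{N}^{\mathrm{sf}}$, the relative density is $$\delta_{\mathrm{rel}}(S):=\lim_{x\to\infty}\frac{\#\{d\in S: d\le x\}}{\#\{d\in\mathbb{N}^{\mathrm{sf}}: d\le x\}},$$ if the limit exists. *)

(* Defs.v *)
From mathcomp Require Import all_boot all_order all_algebra.
From mathcomp Require Import finmap.
From mathcomp Require Import all_classical all_reals all_analysis.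

Set Implicit Arguments.
Unset Strict Implicit.
Unset Printing Implicit Defensive.

Import Order.TTheory GRing.Theory Num.Theory.
Import numFieldNormedType.Exports.

Local Open Scope classical_set_scope.
Local Open Scope ring_scope.

Definition squarefree (d : nat) : Prop :=
  forall m : nat, (m ^ 2 %| d)%N -> m = 1%N.

Definition Nsf : set nat := [set d | (2 <= d)%N /\ squarefree d].

(* The set counted is finite for every real x, so the junk value of [fset_set]
   on infinite sets never occurs. *)
Definition count_le (R : realType) (S : set nat) (x : R) : nat :=
  #|` fset_set [set d | S d /\ d%:R <= x]|%fset.

Definition density_ratio (R : realType) (S : set nat) (x : R) : R :=
  (count_le S x)%:R / (count_le Nsf x)%:R.

(* [delta_rel R S] is meaningful only for [S `<=` Nsf] such that
   [has_delta_rel R S]: [lim] takes an arbitrary value when there is no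
   limit. *)
Definition has_delta_rel (R : realType) (S : set nat) : Prop :=
  cvg (density_ratio S x @[x --> (+oo : set_system R)]).

Definition delta_rel (R : realType) (S : set nat) : R :=
  lim (density_ratio S x @[x --> (+oo : set_system R)]).

Definition U : set nat :=
  [set d | [/\ Nsf d, (5 <= d)%N & (- d%:Z <> 1 %[mod 8])%Z]].

(* Main.v *)
(* Write E(n) = 6 #{k <= n squarefree, k = 7 mod 8} - #{k <= n squarefree}.
   A positive integer N is m^2 k with m odd and k squarefree iff 4 does not
   divide N, and then m and k are unique, and k is congruent to N mod 8.  Hence the sum of
   E(n / m^2) over odd m equals 6 floor((n + 1) / 8) - (n - floor(n / 4)), which
   is bounded by 6.  Isolating the term m = 1 gives |E(n)| <= 24 n^(3/4) by strong
   induction, because sum_{m >= 3 odd} m^(-3/2) <= 1 / sqrt 2 < 3/4 (a telescoping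
   bound).  The same decomposition yields at least n / 2 squarefree k <= n, so
   among squarefree numbers the class 7 mod 8 has density 1/6. *)
Require Import Defs.
From mathcomp Require Import all_boot all_order all_algebra.
From mathcomp Require Import all_classical all_reals all_analysis.
From mathcomp Require Import zify ring lra finmap.
Import Order.TTheory GRing.Theory Num.Theory.
Import numFieldNormedType.Exports.

(** * Unique decomposition into a square and a squarefree part *)

Lemma squarefree_part_unique {m1 m2 k1 k2 : nat} :
  (0 < m1)%N -> (0 < m2)%N -> squarefree k1 -> squarefree k2 ->
  (m1 ^ 2 * k1 = m2 ^ 2 * k2)%N -> m1 = m2.
Proof.
move=> m1_gt0 m2_gt0 sf1 sf2 eqmk.
set g := gcdn m1 m2.
have g_gt0 : (0 < g)%N by rewrite gcdn_gt0 m1_gt0.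
have Em1 : m1 = ((m1 %/ g) * g)%N by rewrite divnK ?dvdn_gcdl.
have Em2 : m2 = ((m2 %/ g) * g)%N by rewrite divnK ?dvdn_gcdr.
set a := (m1 %/ g)%N in Em1; set b := (m2 %/ g)%N in Em2.
have co_ab : coprime a b.
  by rewrite /coprime -(eqn_pmul2r g_gt0) muln_gcdl -Em1 -Em2 mul1n.
have eqab : (a ^ 2 * k1 = b ^ 2 * k2)%N.
  apply/eqP; rewrite -(@eqn_pmul2r (g ^ 2)) ?expn_gt0 ?g_gt0//.
  by rewrite (mulnAC (a ^ 2)) (mulnAC (b ^ 2)) -!expnMn -Em1 -Em2 eqmk.
(* As [a] and [b] are coprime, [a ^ 2] divides [k2] and [b ^ 2] divides [k1]; squarefreeness forces
   both to be 1. *)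
have a1 : a = 1%N.
  apply: sf2; rewrite -(@Gauss_dvdr _ (b ^ 2)) ?coprimeXl ?coprimeXr//.
  by rewrite -eqab dvdn_mulr.
have b1 : b = 1%N.
  apply: sf1; rewrite -(@Gauss_dvdr _ (a ^ 2)) ?coprimeXl ?coprimeXr 1?coprime_sym//.
  by rewrite eqab dvdn_mulr.
by rewrite Em1 Em2 a1 b1.
Qed.

(** Take the largest [m] whose square divides [n]: a square factor [p ^ 2] of the quotient would
    make [p * m] a larger choice unless [p <= 1]. *)
Lemma squarefree_part_exists {n : nat} : (0 < n)%N ->
  exists m, [/\ (0 < m)%N, (m ^ 2 %| n)%N & squarefree (n %/ m ^ 2)%N].
Proof.
move=> n_gt0.
have ex1 : exists m, (m ^ 2 %| n)%N by exists 1%N.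
have ub m : (m ^ 2 %| n)%N -> (m <= n)%N.
  by move=> /(dvdn_leq n_gt0); apply: leq_trans; case: m => // m; rewrite leq_pmulr.
case: (ex_maxnP ex1 ub) => m m_dvd m_max.
have m_gt0 : (0 < m)%N by apply: (m_max 1%N).
exists m; split => // p p_dvd.
have /m_max : ((p * m) ^ 2 %| n)%N.
  by rewrite expnMn -(divnK m_dvd) dvdn_pmul2r ?expn_gt0 ?m_gt0.
rewrite -{2}[m]mul1n leq_pmul2r// => p_le1.
case: p p_dvd p_le1 => [|[|]]// + _.
by rewrite dvd0n eqn0Ngt divn_gt0 ?expn_gt0 ?m_gt0// dvdn_leq.
Qed.

(** Odd [m] is encoded as [j.*2.+1]. If 4 divides [n], it also divides the quotient by any odd
    square. The free bound [b] allows one common range of [j] for all [n <= b]. *)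
Lemma count_odd_square_decompositions (n b : nat) : (0 < n)%N -> (n <= b)%N ->
  (\sum_(j < b.+1 | ((j.*2.+1 ^ 2 %| n)%N && `[< squarefree (n %/ j.*2.+1 ^ 2) >])) 1
   = ~~ (4 %| n))%N.
Proof.
move=> n_gt0 le_nb.
have [n4|n4] := boolP (4 %| n)%N.
  rewrite big1// => j /andP[dvd_n /asboolP sf].
  suff /sf : (2 ^ 2 %| n %/ j.*2.+1 ^ 2)%N by [].
  rewrite -(divnK dvd_n) Gauss_dvdl// in n4.
  by rewrite coprimeXr// (@coprimeXl 2 2)// coprime2n /= odd_double.
have [m [m_gt0 m_dvd sf]] := squarefree_part_exists n_gt0.
have m_odd : odd m.
  apply: contraR n4; rewrite -dvdn2 => m2; apply: dvdn_trans m_dvd.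
  exact: (dvdn_exp2r 2 m2).
have Em : (m./2.*2.+1)%N = m by rewrite -[RHS]odd_double_half m_odd.
have lt_mb : (m./2 < b.+1)%N.
  rewrite ltnS (leq_trans _ le_nb)// (leq_trans _ (dvdn_leq n_gt0 m_dvd))//.
  rewrite (leq_trans (half_leq (leq_addr m m)))// addnn doubleK leq_pmulr//.
rewrite (big_pred1 (Ordinal lt_mb))// => j /=.
apply/andP/eqP => [[j_dvd /asboolP sfj]|->]; last first.
  by rewrite /= Em; split=> //; apply/asboolP.
apply: val_inj => /=; apply: double_inj; apply: succn_inj; rewrite Em.
by apply: (squarefree_part_unique _ _ sfj sf) => //; rewrite !(mulnC (_ ^ 2)) !divnK.
Qed.

(** * Summing squarefree counts over odd squares *)

Definition sf_count (P : pred nat) (n : nat) : nat :=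
  (\sum_(1 <= k < n.+1 | `[< squarefree k >] && P k) 1)%N.

(** The substitution [i = q * k] matches [k <= n %/ q] with the multiples of [q] up to [n]. *)
Lemma sf_count_multiples (P : pred nat) (n q : nat) : (0 < q)%N ->
  (forall k, P (q * k)%N = P k) ->
  sf_count P (n %/ q) =
  (\sum_(1 <= i < n.+1 | [&& q %| i, `[< squarefree (i %/ q) >] & P i]) 1)%N.
Proof.
move=> q_gt0 Pq; elim: n => [|n IH].
  by rewrite div0n /sf_count !big_geq.
have P_dvd : (q %| n.+1)%N -> P n.+1 = P (n %/ q).+1.
  by move=> qn; rewrite -(Pq (n %/ q).+1) mulnC -[in LHS](divnK qn) divnS// qn.
rewrite big_mkcond big_nat_recr//= -big_mkcond /= -IH divnS//.
have [qn|qn] := boolP (q %| n.+1)%N; last by rewrite addn0 add0n.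
rewrite add1n /sf_count big_mkcond big_nat_recr//= -big_mkcond /=.
by rewrite P_dvd.
Qed.

(** After exchanging the sums, each [i] satisfying [P] is counted once per decomposition as an odd
    square times a squarefree number. *)
Lemma sum_sf_count (P : pred nat) (n : nat) :
  (forall m k, odd m -> P (m ^ 2 * k)%N = P k) ->
  (\sum_(0 <= j < n.+1) sf_count P (n %/ j.*2.+1 ^ 2) =
   \sum_(1 <= i < n.+1 | ~~ (4 %| i) && P i) 1)%N.
Proof.
move=> Podd.
pose F (j i : nat) :=
  [&& j.*2.+1 ^ 2 %| i, `[< squarefree (i %/ j.*2.+1 ^ 2) >] & P i]%N.
rewrite (eq_bigr (fun j => \sum_(1 <= i < n.+1) F j i)%N) => [|j _]; last first.
  rewrite sf_count_multiples ?expn_gt0// => [|k]; last by rewrite Podd//= odd_double.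
  by rewrite big_mkcond; apply: eq_bigr => i _; rewrite /F; case: ifP.
rewrite exchange_big_nat /= [RHS]big_mkcond; apply: eq_big_nat => i /andP[i_gt0 i_le].
rewrite big_mkord; have [Pi|nPi] := boolP (P i); last first.
  by rewrite andbF big1// => j _; rewrite /F (negPf nPi) !andbF.
rewrite andbT -[RHS]/(nat_of_bool (~~ (4 %| i)%N)).
rewrite -(@count_odd_square_decompositions i n)//.
by rewrite [RHS]big_mkcond; apply: eq_bigr => j _; rewrite /F Pi andbT; case: ifP.
Qed.

Lemma count_not_multiple4 (n : nat) :
  (\sum_(1 <= i < n.+1 | ~~ (4 %| i) && predT i) 1 = n - n %/ 4)%N.
Proof.
elim: n => [|n IH]; first by rewrite big_geq.
by rewrite big_mkcond big_nat_recr//= -big_mkcond /= IH andbT; case: ifP; lia.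
Qed.

Lemma count_eq7_mod8 (n : nat) :
  (\sum_(1 <= i < n.+1 | ~~ (4 %| i) && (i %% 8 == 7)) 1 = n.+1 %/ 8)%N.
Proof.
elim: n => [|n IH]; first by rewrite big_geq.
by rewrite big_mkcond big_nat_recr//= -big_mkcond /= IH; case: ifP; lia.
Qed.

Lemma modn8_odd_square_mul (m k : nat) : odd m -> ((m ^ 2 * k) %% 8 = k %% 8)%N.
Proof.
move=> m_odd; rewrite -modnMml -modnXm.
have : (m %% 8 < 8)%N by rewrite ltn_mod.
have : odd (m %% 8)%N by rewrite odd_mod.
by case: (m %% 8)%N => [|[|[|[|[|[|[|[|]]]]]]]]//= _ _; rewrite mul1n.
Qed.

(** * Telescoping bounds for sums over odd numbers *)

Local Open Scope ring_scope.

(** With [a], [b] the roots of [x - 1], [x + 1], the right side is [2 / (a * b * (a + b))], where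
    [a * b <= x] and [a + b <= 2 * Num.sqrt x]. *)
Lemma inv_sqrt_diff_ge (R : rcfType) (x : R) : 1 < x ->
  (x * Num.sqrt x)^-1 <= (Num.sqrt (x - 1))^-1 - (Num.sqrt (x + 1))^-1.
Proof.
move=> x_gt1.
set a := Num.sqrt (x - 1); set b := Num.sqrt (x + 1); set c := Num.sqrt x.
have a_gt0 : 0 < a by rewrite sqrtr_gt0 subr_gt0.
have b_gt0 : 0 < b by rewrite sqrtr_gt0; lra.
have c_gt0 : 0 < c by rewrite sqrtr_gt0; lra.
have Ea : a ^+ 2 = x - 1 by rewrite sqr_sqrtr; lra.
have Eb : b ^+ 2 = x + 1 by rewrite sqr_sqrtr; lra.
have Ec : c ^+ 2 = x by rewrite sqr_sqrtr; lra.
have le_ab : a * b <= x.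
  have := sqr_ge0 (a - b); rewrite sqrrB Ea Eb; lra.
have le_abc : a + b <= 2 * c.
  rewrite -(@ler_pXn2r _ 2) ?nnegrE; [|by []|lra|lra].
  rewrite exprMn sqrrD Ea Eb Ec; lra.
have -> : a^-1 - b^-1 = (a * b)^-1 * (2 / (a + b)).
  have -> : 2 = (b - a) * (a + b) by rewrite (addrC a) -subr_sqr Ea Eb; ring.
  by field; rewrite !gt_eqF// addr_gt0.
rewrite invfM ler_pM ?invr_ge0//; try lra.
  by rewrite lef_pV2 ?posrE ?mulr_gt0//; lra.
rewrite -invf_div lef_pV2 ?posrE ?divr_gt0 ?addr_gt0//.
by rewrite ler_pdivrMr// mulrC.
Qed.

Lemma natr_divn_sqr_le (R : realFieldType) (n m : nat) : (0 < m)%N ->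
  (n %/ m ^ 2)%:R * m%:R ^+ 2 <= n%:R :> R.
Proof. by move=> m_gt0; rewrite -natrX -natrM ler_nat leq_divM. Qed.

Lemma sum_odd_inv_sqr_le (R : realFieldType) (n : nat) :
  \sum_(0 <= j < n) ((j.*2.+3)%:R ^+ 2)^-1 <= 1 / 4 :> R.
Proof.
(* Lowering the denominator [(2j+3)^2] by 1 gives [4(j+1)(j+2)], whose inverse is [t j.+1 - t j]. *)
pose t (j : nat) : R := - (4 * j.+1%:R)^-1.
apply: (@le_trans _ _ (\sum_(0 <= j < n) (t j.+1 - t j))).
  apply: ler_sum => j _; rewrite /t.
  have -> : j.*2.+3%:R = 2 * j%:R + 3 :> R by rewrite -mul2n -addn3 natrD natrM.
  rewrite -[j.+2]addn2 -[j.+1]addn1 !natrD.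
  have j_ge0 : 0 <= j%:R :> R by [].
  set x := j%:R in j_ge0 *.
  have -> : - (4 * (x + 2))^-1 - - (4 * (x + 1))^-1 = ((2 * x + 3) ^+ 2 - 1)^-1.
    by field; rewrite !gt_eqF//; nra.
  by rewrite lef_pV2 ?posrE; nra.
rewrite telescope_sumr// /t opprK mulr1.
have : 0 <= (4 * n.+1%:R : R)^-1 by rewrite invr_ge0 mulr_ge0.
by rewrite mul1r addrC gerDl oppr_le0.
Qed.

(** * Equidistribution of the class 7 mod 8 among squarefree numbers *)

Definition eq7_mod8 : pred nat := fun k => (k %% 8 == 7)%N.

Definition sf_bias (R : realType) (n : nat) : R :=
  6 * (sf_count eq7_mod8 n)%:R - (sf_count predT n)%:R.

Lemma sum_sf_count_predT (n : nat) :
  (\sum_(0 <= j < n.+1) sf_count predT (n %/ j.*2.+1 ^ 2) = n - n %/ 4)%N.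
Proof. by rewrite sum_sf_count// count_not_multiple4. Qed.

Lemma sum_sf_count_eq7_mod8 (n : nat) :
  (\sum_(0 <= j < n.+1) sf_count eq7_mod8 (n %/ j.*2.+1 ^ 2) = n.+1 %/ 8)%N.
Proof.
rewrite sum_sf_count; last by move=> m k m_odd; rewrite /eq7_mod8 modn8_odd_square_mul.
exact: count_eq7_mod8.
Qed.

Lemma normr_sum_sf_bias (R : realType) (n : nat) :
  `|\sum_(0 <= j < n.+1) sf_bias R (n %/ j.*2.+1 ^ 2)| <= 6.
Proof.
rewrite /sf_bias sumrB -mulr_sumr -!natr_sum sum_sf_count_predT sum_sf_count_eq7_mod8.
rewrite -natrM ler_distl; apply/andP; split.
  by rewrite lerBlDr -natrD ler_nat; lia.
by rewrite -natrD ler_nat; lia.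
Qed.

(** This is [n^(3/4)], written with square roots only. *)
Definition pow34 (R : realType) (n : nat) : R :=
  Num.sqrt n%:R * Num.sqrt (Num.sqrt n%:R).

Lemma pow34_divn_le (R : realType) (n m : nat) : (0 < m)%N ->
  pow34 R (n %/ m ^ 2) <= pow34 R n * (m%:R * Num.sqrt m%:R)^-1.
Proof.
move=> m_gt0.
have mR_gt0 : 0 < m%:R :> R by rewrite ltr0n.
have le1 : Num.sqrt (n %/ m ^ 2)%:R * m%:R <= Num.sqrt n%:R :> R.
  rewrite -[X in _ * X]ger0_norm ?ler0n// -sqrtr_sqr -sqrtrM ?ler0n//.
  by rewrite ler_wsqrtr// natr_divn_sqr_le.
have le2 : Num.sqrt (Num.sqrt (n %/ m ^ 2)%:R) * Num.sqrt m%:R <=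
    Num.sqrt (Num.sqrt n%:R) :> R.
  by rewrite -sqrtrM ?sqrtr_ge0// ler_wsqrtr.
rewrite ler_pdivlMr ?mulr_gt0 ?sqrtr_gt0// /pow34 mulrACA ler_pM// mulr_ge0 ?sqrtr_ge0.
Qed.

Lemma pow34_ge1 (R : realType) (n : nat) : (0 < n)%N -> 1 <= pow34 R n.
Proof.
move=> n_gt0; have s1 : 1 <= Num.sqrt n%:R :> R.
  by rewrite -[X in X <= _]sqrtr1 ler_wsqrtr// ler1n.
have s2 : 1 <= Num.sqrt (Num.sqrt n%:R) :> R.
  by rewrite -[X in X <= _]sqrtr1 ler_wsqrtr.
by rewrite /pow34 mulr_ege1.
Qed.

Lemma sum_pow34_le (R : realType) (n : nat) :
  \sum_(0 <= j < n) pow34 R (n %/ j.*2.+3 ^ 2) <= pow34 R n * (3 / 4).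
Proof.
(* The even neighbours [2j+2] and [2j+4] of the odd number [2j+3] make the bound of
   [inv_sqrt_diff_ge] telescope. *)
pose t (j : nat) : R := - (Num.sqrt (j.*2.+2)%:R)^-1.
have pow34_ge0 : 0 <= pow34 R n by rewrite mulr_ge0 ?sqrtr_ge0.
apply: (@le_trans _ _ (\sum_(0 <= j < n) pow34 R n * (t j.+1 - t j))).
  apply: ler_sum => j _; apply: (le_trans (pow34_divn_le R n _ _)) => //.
  rewrite ler_wpM2l// /t opprK addrC.
  have := @inv_sqrt_diff_ge R j.*2.+3%:R; rewrite ltr1n => /(_ isT).
  by rewrite -[X in X - 1]natr1 addrK natr1 -doubleS.
rewrite -mulr_sumr ler_wpM2l// telescope_sumr// /t opprK double0.
have : 0 <= (Num.sqrt (n.*2.+2)%:R : R)^-1 by rewrite invr_ge0 sqrtr_ge0.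
suff : (Num.sqrt 2 : R)^-1 <= 3 / 4 by lra.
rewrite -[X in _ <= X]invf_div lef_pV2 ?posrE ?sqrtr_gt0; [|lra|lra].
rewrite -(@ler_pXn2r _ 2) ?nnegrE ?sqrtr_ge0//.
by rewrite sqr_sqrtr; lra.
Qed.

(** The constant 24 solves [6 + (3/4) C = C], which closes the induction once the 6 is absorbed by
    [pow34 R n >= 1]. *)
Lemma normr_sf_bias_le (R : realType) (n : nat) : `|sf_bias R n| <= 24 * pow34 R n.
Proof.
elim/ltn_ind: n => n IH.
have [->|n_gt0] := posnP n.
  rewrite /sf_bias /sf_count !big_geq// mulr0 subrr normr0.
  by rewrite mulr_ge0 ?mulr_ge0 ?sqrtr_ge0.
have := normr_sum_sf_bias R n.
rewrite big_nat_recl//= double0 exp1n divn1.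
set s := \sum_(0 <= _ < _) _ => le6.
have : `|s| <= 24 * (pow34 R n * (3 / 4)).
  apply: (le_trans (ler_norm_sum _ _ _)).
  apply: (@le_trans _ _ (\sum_(0 <= j < n) 24 * pow34 R (n %/ j.*2.+3 ^ 2))).
    by apply: ler_sum => j _; apply: IH; rewrite ltn_Pdiv//; lia.
  by rewrite -mulr_sumr ler_wpM2l// sum_pow34_le.
have := pow34_ge1 R n n_gt0.
have : `|sf_bias R n| <= `|sf_bias R n + s| + `|s|.
  by rewrite -[in X in X <= _](addrK s (sf_bias R n)) ler_normB.
lra.
Qed.

Lemma sf_count_le (P : pred nat) (n : nat) : (sf_count P n <= n)%N.
Proof.
rewrite /sf_count big_mkcond -[X in (_ <= X)%N](subn1 n.+1) -[X in (_ <= X)%N]muln1.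
by rewrite -sum_nat_const_nat; apply: leq_sum => i _; case: ifP.
Qed.

(** The sum over odd [m] is at least [3n/4], and bounding each term with [m >= 3] trivially by
    [n / m^2] removes at most [n/4]. *)
Lemma sf_count_ge (R : realType) (n : nat) : n%:R / 2 <= (sf_count predT n)%:R :> R.
Proof.
have := sum_sf_count_predT n.
rewrite big_nat_recl//= double0 exp1n divn1 => /(congr1 (fun k => k%:R : R)).
rewrite natrD natr_sum => eq_sum.
have : \sum_(0 <= j < n) (sf_count predT (n %/ j.*2.+3 ^ 2))%:R <= n%:R * (1 / 4) :> R.
  apply: le_trans (ler_wpM2l (ler0n R n) (sum_odd_inv_sqr_le R n)).
  rewrite mulr_sumr; apply: ler_sum => j _.
  rewrite ler_pdivlMr ?exprn_gt0 ?ltr0n//.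
  apply: le_trans (natr_divn_sqr_le R n j.*2.+3 _) => //.
  by rewrite ler_wpM2r ?exprn_ge0// ler_nat sf_count_le.
have : n%:R * 3 / 4 <= (n - n %/ 4)%:R :> R.
  by rewrite ler_pdivrMr// -!natrM ler_nat; lia.
rewrite -eq_sum => h1 h2.
have := le_trans h1 (lerD (lexx _) h2).
lra.
Qed.

(** * From the counts at real arguments to sums over integers *)

Lemma mem_U (d : nat) : U d <-> [/\ squarefree d, (5 <= d)%N & ~~ eq7_mod8 d].
Proof.
rewrite /U /Nsf /eq7_mod8 /=; split.
  by move=> [[d2 sf] d5 d8]; split=> //; apply/negP => /eqP d7; apply: d8; lia.
by move=> [sf d5 d7]; do ?split=> //; lia.
Qed.

Lemma count_le_truncn (R : realType) (S : set nat) (x : R) : 0 <= x -> ~ S 0%N ->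
  count_le S x = (\sum_(1 <= d < (Num.truncn x).+1 | `[< S d >]) 1)%N.
Proof.
move=> x_ge0 S0; rewrite /count_le.
set n := Num.truncn x.
have -> : [set d | S d /\ d%:R <= x]%classic =
    [set` [fset d in [seq d <- index_iota 1 n.+1 | `[< S d >]]]%fset]%classic.
  apply/seteqP; split=> d /=; rewrite !inE mem_filter mem_index_iota ltnS.
    move=> [Sd dx]; apply/andP; split; first exact/asboolP.
    rewrite truncn_ge_nat// dx andbT lt0n; by apply: contra_notN S0 => /eqP <-.
  by move=> /and3P[/asboolP Sd _]; rewrite truncn_ge_nat.
rewrite set_fsetK card_fseq undup_id ?filter_uniq ?iota_uniq//.
by rewrite size_filter sum1_count.
Qed.

Lemma count_small (n m : nat) : (\sum_(1 <= d < n.+1) (d <= m) <= m)%N.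
Proof.
suff -> : (\sum_(1 <= d < n.+1) (d <= m) = minn n m)%N by rewrite geq_minr.
by elim: n => [|n IH]; [rewrite big_geq// min0n|rewrite big_nat_recr//= IH; lia].
Qed.

(** The slack 1 accounts for [d = 1], which is squarefree but not in [Nsf]. *)
Lemma count_Nsf_bounds (R : realType) (x : R) : 0 <= x ->
  (count_le Nsf x <= sf_count predT (Num.truncn x) <= count_le Nsf x + 1)%N.
Proof.
move=> x_ge0; rewrite count_le_truncn//; last by case.
set n := Num.truncn x; rewrite /sf_count !(big_mkcond (fun _ => asbool _)) /=.
rewrite (big_mkcond (fun _ => asbool _ && _)) /=.
apply/andP; split.
  apply: leq_sum => d _; rewrite andbT.
  by case: asboolP => // -[_ /asboolP ->].
apply: leq_trans (leq_add (leqnn _) (count_small n 1)).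
rewrite -big_split; apply: leq_sum => d _; rewrite andbT.
case: asboolP => // sf; case: asboolP => [|nN]//=.
by case: (leqP d 1) => // d2; case: nN; split.
Qed.

(** A squarefree [d] is in [U], or is 7 mod 8, or is at most 4; the slack 4 covers the last case. *)
Lemma count_U_bounds (R : realType) (x : R) : 0 <= x ->
  (count_le U x + sf_count eq7_mod8 (Num.truncn x) <= sf_count predT (Num.truncn x)
     <= count_le U x + sf_count eq7_mod8 (Num.truncn x) + 4)%N.
Proof.
move=> x_ge0; rewrite count_le_truncn//; last by move=> /mem_U [].
set n := Num.truncn x; rewrite /sf_count (big_mkcond (fun _ => asbool (U _))) /=.
rewrite !(big_mkcond (fun _ => asbool _ && _)) /=.
apply/andP; split.
  rewrite -big_split; apply: leq_sum => d _ /=; rewrite andbT.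
  case: (asboolP (U d)) => [/mem_U[/asboolP -> _ /negPf ->]//|_].
  by case: asboolP => //= _; case: ifP.
apply: leq_trans (leq_add (leqnn _) (count_small n 4)).
rewrite -!big_split; apply: leq_sum => d _ /=; rewrite andbT.
case: (asboolP (squarefree d)) => //= sf.
case: (boolP (eq7_mod8 d)) => [d7|nd7]; first by rewrite -addnA addnC.
case: (leqP d 4) => [_|d5]; first by rewrite addn1.
by have /asboolP -> : U d by apply/mem_U.
Qed.

(** * Rate of convergence and the limit *)

Lemma density_ratio_U_dist (R : realType) (x : R) : 4 <= x ->
  `|5 / 6 - density_ratio U x| <=
  32 / Num.sqrt (Num.sqrt (Num.truncn x)%:R).
Proof.
move=> x_ge4; have x_ge0 : 0 <= x by lra.
have n_ge4 : (4 <= Num.truncn x)%N by rewrite truncn_ge_nat.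
have := sf_count_ge R (Num.truncn x).
have := normr_sf_bias_le R (Num.truncn x).
have := pow34_ge1 R (Num.truncn x) (leq_trans (isT : 0 < 4)%N n_ge4).
have := count_U_bounds R x x_ge0; have := count_Nsf_bounds R x x_ge0.
rewrite /density_ratio /sf_bias /pow34.
move: (Num.truncn x) n_ge4 => n n_ge4.
move: (count_le Nsf x) (count_le U x) (sf_count predT n) => N u a.
move: (sf_count eq7_mod8 n) => b.
rewrite -!(ler_nat R) !natrD => /andP[N1 N2] /andP[u1 u2].
rewrite -(ler_nat R) in n_ge4.
move: (N%:R : R) (u%:R : R) (a%:R : R) (b%:R : R) N1 N2 u1 u2 => {}N {}u {}a {}b.
move=> N1 N2 u1 u2.
set s := Num.sqrt n%:R; set q := Num.sqrt s => pow34_n bias a_ge.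
have s_ge0 : 0 <= s by rewrite sqrtr_ge0.
have q_ge0 : 0 <= q by rewrite sqrtr_ge0.
have Es : s ^+ 2 = n%:R by rewrite sqr_sqrtr ?ler0n.
have Eq : q ^+ 2 = s by rewrite sqr_sqrtr.
have q_gt0 : 0 < q by rewrite sqrtr_gt0 sqrtr_gt0; lra.
(* Here [N >= a - 1 >= n/2 - 1], and [n >= 4]. *)
have N_ge : n%:R / 4 <= N by lra.
have N_gt0 : 0 < N by lra.
have -> : 5 / 6 - u / N = (5 * N - 6 * u) / (6 * N) by field; rewrite gt_eqF.
rewrite normrM normfV (@gtr0_norm _ (6 * N)); last lra.
(* The numerator lies between the bias minus 5 and the bias plus 24, and [s * q >= 1] turns the 24
   into a second [24 * (s * q)]. *)
have : `|5 * N - 6 * u| <= 48 * (s * q).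
  by move: bias; rewrite !ler_norml => /andP[b1 b2]; apply/andP; split; lra.
rewrite ler_pdivrMr; last lra.
move=> /le_trans; apply.
rewrite mulrAC ler_pdivlMr// -mulrA -mulrA -expr2 Eq -expr2 Es; lra.
Qed.

Theorem proposition1p12 (R : realType) :
  has_delta_rel R U /\ delta_rel R U = 5 / 6.
Proof.
suff cvU : (density_ratio U x @[x --> (+oo : set_system R)] --> (5 / 6 : R))%classic.
  by split; [apply/cvg_ex; exists (5 / 6)|apply: cvg_lim].
apply/cvgrPdist_le => e e_gt0; near=> x.
have x_ge4 : 4 <= x by near: x; apply: nbhs_pinfty_ge; rewrite num_real.
apply: (le_trans (density_ratio_U_dist R x x_ge4)).
(* The fourth power undoes the nested roots; the extra 1 pays for truncating [x]. *)
have x_ge : ((32 / e) ^+ 2) ^+ 2 + 1 <= x.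
  by near: x; apply: nbhs_pinfty_ge; rewrite num_real.
have x_ge0 : 0 <= x by apply: le_trans x_ge; rewrite addr_ge0 ?sqr_ge0.
have /andP[_ lt_x] := truncn_itv x_ge0.
rewrite -natr1 in lt_x.
have d_gt0 : 0 < 32 / e by rewrite divr_gt0.
have q_ge : 32 / e <= Num.sqrt (Num.sqrt (Num.truncn x)%:R).
  rewrite -[X in X <= _]ger0_norm ?(ltW d_gt0)// -sqrtr_sqr ler_wsqrtr//.
  rewrite -[X in X <= _]ger0_norm ?sqr_ge0// -sqrtr_sqr ler_wsqrtr//.
  by apply: ltW; lra.
rewrite ler_pdivrMr ?(lt_le_trans d_gt0)// mulrC.
by rewrite -ler_pdivrMr.
Unshelve. all: by end_near.
Qed.
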